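(* Let $b\ge 2$ and $n\ge 1$ be integers, let $\mathcal D=\{d,d+1,\dots,d+b-1\}$ be a set of consecutive integers containing $0$, and consider the $n$-carry process over $(b,\mathcal D)$ with state space $\Omega=\Omega_n(b,\mathcal D)=\{s,s+1,\dots,s+m-1\}$ ($s$ its minimal element, $m=\#\Omega$). Put $l=d/(b-1)$ and $$p=\begin{cases}\dfrac{1}{\{(n-1)(-l)\}} & \text{if } (n-1)l\notin\mathbb Z,\\[2mm] 1 & \text{if } (n-1)l\in\mathbb Z,\end{cases}$$ where $\{x\}=x-\lfloor x\rfloor$. Let $P=(\tilde p_{i,j})_{0\le i,j\le m-1}$ with $\tilde p_{i,j}=\Pr(C_{t+1}=j+s\mid C_t=i+s)$, and let $V=\big(v^{(p)}_{i,j}(n)\big)_{0\le i,j\le m-1}$. Then $V$ is invertible and $$VPV^{-1}=\mathrm{diag}\big(1,b^{-1},b^{-2},\dots,b^{-(m-1)}\big).$$ In particular the stationary distribution $\pi$ of the carries process is $$\pi(s+k)=\frac{1}{p^n\,n!}\,A^{(p)}(n,k),\qquad k=0,1,\dots,m-1.$$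
   Context: Carries process over $(b,\mathcal D)$: let $\{X_{k,i}\}_{1\le k\le n,\ i\ge 0}$ be independent random variables, each uniformly distributed on $\mathcal D$. Set $C_0=0$; for $i\ge 0$ let $A_i$ be the unique element of $\mathcal D$ with $A_i\equiv C_i+X_{1,i}+\dots+X_{n,i}\pmod b$, and set $C_{i+1}=(C_i+X_{1,i}+\dots+X_{n,i}-A_i)/b$. $(C_i)_{i\ge0}$ is a Markov chain (the $n$-carry process over $(b,\mathcal D)$); its state space $\Omega_n(b,\mathcal D)$ is the set of integers $c$ with $\Pr(C_i=c)>0$ for some $i\ge 0$, which is a set of consecutive integers. Generalized Eulerian numbers: for real $p\ge1$, integer $n\ge 0$, $0\le i\le n$ and $0\le j\le n+1$, $$v^{(p)}_{i,j}(n)=\sum_{r=0}^{j}(-1)^r\binom{n+1}{r}\,[p(j-r)+1]^{\,n-i},$$ with $v^{(p)}_{i,-1}(n)=0$, and $A^{(p)}(n,j)=v^{(p)}_{0,j}(n)$. *)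

(* Defs.v *)
From HB Require Import structures.
From mathcomp Require Import all_boot all_order all_algebra.
Set Implicit Arguments. Unset Strict Implicit. Unset Printing Implicit Defensive.
Import Order.TTheory GRing.Theory Num.Theory.
Local Open Scope ring_scope.

(* Digits: D = {d, d+1, ..., d+b-1}; a digit vector (X_1,...,X_n) is encoded by
   x : {ffun 'I_n -> 'I_b} with X_k = d + x k. *)

(* One step of the carries process: from carry c and digits X_k = d + x k,
   S = c + X_1 + ... + X_n, A = the unique element of D congruent to S mod b,
   i.e. A = d + ((S - d) mod b), and the next carry is (S - A)/b. *)
Definition digit_sum (b n : nat) (d : int) (x : {ffun 'I_n -> 'I_b}) : int :=
  \sum_(k < n) (d + (x k : nat)%:Z).

Definition next_carry (b n : nat) (d c : int) (x : {ffun 'I_n -> 'I_b}) : int :=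
  let S := c + digit_sum d x in
  let A := d + ((S - d) %% (b : int))%Z in
  ((S - A) %/ (b : int))%Z.

(* States c with Pr(C_i = c) > 0 for some i: since all digit vectors have
   positive probability, these are the states reachable from C_0 = 0. *)
Inductive reachable (b n : nat) (d : int) : int -> Prop :=
| reach0 : reachable b n d 0
| reachS : forall c (x : {ffun 'I_n -> 'I_b}),
    reachable b n d c -> reachable b n d (next_carry d c x).

Definition trans_prob (b n : nat) (d c c' : int) : rat :=
  (#|[set x : {ffun 'I_n -> 'I_b} | next_carry d c x == c']|)%:R / (b ^ n)%:R.

Definition carry_matrix (b n : nat) (d s : int) (m : nat) : 'M[rat]_m :=
  \matrix_(i < m, j < m) trans_prob b n d (s + (i : nat)%:Z) (s + (j : nat)%:Z).

Definition fracq (x : rat) : rat := x - (Num.floor x)%:~R.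

Definition ell (b : nat) (d : int) : rat := d%:~R / (b%:R - 1).

Definition pparam (b n : nat) (d : int) : rat :=
  let l := ell b d in
  if ((n%:R - 1) * l) \is a Num.int then 1
  else (fracq ((n%:R - 1) * (- l)))^-1.

Definition veul (p : rat) (n i j : nat) : rat :=
  \sum_(r < j.+1) (-1) ^+ r * ('C(n.+1, r))%:R * (p * (j - r)%:R + 1) ^+ (n - i).

Definition Aeul (p : rat) (n j : nat) : rat := veul p n 0 j.

Definition Vmatrix (p : rat) (n m : nat) : 'M[rat]_m :=
  \matrix_(i < m, j < m) veul p n i j.

(* Main.v *)
Require Import Defs.
From HB Require Import structures.
From mathcomp Require Import all_boot all_order all_algebra.
From mathcomp Require Import zify ring lra.
Set Implicit Arguments. Unset Strict Implicit. Unset Printing Implicit Defensive.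
Import Order.TTheory GRing.Theory Num.Theory.
Local Open Scope ring_scope.

(* Put E = (n - 1) d.  The next carry is floor ((c + E + \sum_k x_k) / b) with
   0 <= x_k < b, so the state space is determined by the drift at its ends:
   s = floor ((n - 1) l), and m = n or n + 1 according to whether (n - 1) l is
   an integer.  In both cases T := (b - 1) (s + 1) - E = (b - 1) / p, and
   P_(k, j) is b^-n times the coefficient of X^(b j + T) in
   X^k ((1 - X^b) / (1 - X))^(n + 1).
   Row i of V has generating function
   v_i(X) = (1 - X)^(n + 1) \sum_k (p k + 1)^(n - i) X^k, so the factors
   (1 - X)^(n + 1) cancel in v_i P, and p (b k + T) + 1 = b (p k + 1) shows
   that v_i is a left eigenvector with eigenvalue b^-i.  These eigenvalues are
   distinct and v_i(0) = 1, whence V is invertible.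
   The sign and the sum of row 0 come from the Eulerian recurrence in n. *)

(** * Generalized Eulerian numbers: recurrence, support, sign and sum *)

(* Coefficient of z^j in (1 - z)^N * \sum_k (p k + 1)^e z^k. *)
Definition eulsum (R : comNzRingType) (p : R) (N e j : nat) : R :=
  \sum_(r < j.+1) (-1) ^+ r * ('C(N, r))%:R * (p * (j - r)%:R + 1) ^+ e.

Lemma eulsum_at0 (R : comNzRingType) (p : R) N e : eulsum p N e 0 = 1.
Proof. by rewrite /eulsum big_ord1 bin0 subnn mulr0 add0r expr1n !mulr1. Qed.

Lemma eulsumS (R : comNzRingType) (p : R) N e j :
  eulsum p N.+1 e j.+1 = eulsum p N e j.+1 - eulsum p N e j.
Proof.
rewrite /eulsum big_ord_recl [in X in _ = X - _]big_ord_recl /= -addrA -sumrB.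
congr (_ + _); first by rewrite !bin0.
by apply: eq_bigr => r _; rewrite /bump /= add1n subSS binS natrD exprS; ring.
Qed.

(** Termwise, the two sides differ by a multiple of the absorption identity (r + 1) C(n+1, r+1) = (n
    + 1 - r) C(n+1, r). No bound on j is imposed, so the recurrence also governs the vanishing for
    large j. *)
Lemma eulsum_rec (R : comNzRingType) (p : R) n j :
  eulsum p n.+2 n.+1 j.+1 =
  (1 + p * j.+1%:R) * eulsum p n.+1 n j.+1
  + (p * (n.+1%:R - j%:R) - 1) * eulsum p n.+1 n j.
Proof.
rewrite /eulsum big_ord_recl [in X in _ = _ * X + _]big_ord_recl /=.
rewrite mulrDr -addrA !mulr_sumr -big_split /=.
congr (_ + _); first by rewrite !bin0 subn0 exprS; ring.
apply: eq_bigr => r _; rewrite /bump /= add1n subSS binS natrD.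
have rj : (r <= j)%N by rewrite -ltnS.
have Hb : r.+1%:R * 'C(n.+1, r.+1)%:R = (n.+1%:R - r%:R) * 'C(n.+1, r)%:R :> R.
  rewrite -natrM mul_bin_left natrM.
  case: (leqP r n.+1) => h; first by rewrite natrB.
  by rewrite bin_small // !mulr0.
rewrite natrB // !exprS.
set y := (_ ^+ n); set c1 := 'C(_, r.+1)%:R in Hb *; set c0 := 'C(_, r)%:R in Hb *.
have -> : j.+1%:R = j%:R + 1 :> R by rewrite -natr1.
apply/eqP; rewrite -subr_eq0; apply/eqP.
transitivity ((-1) ^+ r * p * y * ((r%:R + 1) * c1 - (n.+1%:R - r%:R) * c0)).
  ring.
by rewrite natr1 Hb subrr mulr0.
Qed.

(** The series \sum_k (p k + 1)^e z^k has a pole of order at most e + 1 at z = 1. The case N = e + 1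
    follows from [eulsum_rec] by induction on e; each further factor 1 - z is handled by
    [eulsumS]. *)
Lemma eulsum_out (R : comNzRingType) (p : R) N e j :
  (e < N)%N -> (N <= j)%N -> eulsum p N e j = 0.
Proof.
suff H : forall N' e' j', (e' + N'.+1 <= j')%N -> eulsum p (e' + N'.+1) e' j' = 0.
  by move=> eN Nj; rewrite -(subnKC eN) addSnnS H // -addSnnS subnKC.
elim=> [|N' IH] e' j'; last first.
  by case: j' => [|j'] hj; rewrite addnS ?eulsumS ?IH ?subrr //; lia.
rewrite addn1; elim: e' j' => [|e' IH] [|j'] // hj.
- have H0 k : eulsum p 0 0 k = 1.
    rewrite /eulsum big_ord_recl big1 /= => [|i _]; first by rewrite bin0; ring.
    by rewrite /bump bin_small // mulr0 mul0r.
  by rewrite eulsumS !H0 subrr.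
- by rewrite eulsum_rec !IH ?mulr0 ?addr0 //; lia.
Qed.

(** For p = 1 the second coefficient p (n + 1 - j) - 1 of [eulsum_rec] vanishes at j = n, so the
    degree drops by one more. *)
Lemma eulsum1_out (R : comNzRingType) N e j :
  (0 < e < N)%N -> (N.-1 <= j)%N -> eulsum (1 : R) N e j = 0.
Proof.
suff H : forall N' e' j', (0 < e')%N -> (e' + N' <= j')%N ->
    eulsum (1 : R) (e' + N').+1 e' j' = 0.
  by move=> /andP[e0 eN] Nj; rewrite -(ltn_predK eN) -(subnKC (_ : e <= N.-1)%N) ?H //; lia.
elim=> [|N' IH] e' j' e0.
  case: e' e0 => // e' _; rewrite addn0; case: j' => // j'; rewrite ltnS => hj.
  rewrite eulsum_rec (@eulsum_out _ _ _ _ j'.+1) // mulr0 add0r.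
  move: hj; rewrite leq_eqVlt => /orP[/eqP <-|hj]; last by rewrite eulsum_out ?mulr0.
  by rewrite -natr1; ring.
case: j' => [|j'] hj; first by lia.
by rewrite addnS eulsumS !IH ?subrr //; lia.
Qed.

Lemma eulsum_ge0 (R : numDomainType) (p : R) n j :
  1 <= p -> 0 <= eulsum p n.+1 n j.
Proof.
move=> p1; have p0 : 0 <= p by apply: le_trans p1.
elim: n j => [|n IH] [|j]; rewrite ?eulsum_at0 //; first by rewrite eulsum_out.
case: (leqP j n) => hj; last by rewrite eulsum_out.
have h1 : 0 <= 1 + p * j.+1%:R by rewrite addr_ge0 ?mulr_ge0.
have h2 : 0 <= p * (n.+1%:R - j%:R) - 1.
  by rewrite subr_ge0 (le_trans p1) // ler_peMr // -natrB ?ler1n; lia.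
by rewrite eulsum_rec addr_ge0 // mulr_ge0.
Qed.

(** In the summed recurrence, the j-th term of the previous row gets the weight (1 + p j) + (p (n +
    1 - j) - 1) = p (n + 1). *)
Lemma sum_eulsum (R : comNzRingType) (p : R) n :
  \sum_(j < n.+1) eulsum p n.+1 n j = p ^+ n * n`!%:R.
Proof.
elim: n => [|n IH]; first by rewrite big_ord1 eulsum_at0 mulr1.
rewrite big_ord_recl eulsum_at0 (eq_bigr _ (fun (i : 'I_n.+1) _ => eulsum_rec p n i)).
rewrite big_split /= addrA.
have -> : 1 + \sum_(i < n.+1) (1 + p * i.+1%:R) * eulsum p n.+1 n i.+1
        = \sum_(i < n.+1) (1 + p * i%:R) * eulsum p n.+1 n i.
  rewrite big_ord_recr big_ord_recl /= eulsum_at0 (@eulsum_out _ p _ n n.+1) //.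
  by rewrite !mulr0 !addr0 mulr1.
rewrite -big_split /= factS natrM exprS.
transitivity (p * n.+1%:R * \sum_(j < n.+1) eulsum p n.+1 n j); last by rewrite IH; ring.
by rewrite mulr_sumr; apply: eq_bigr => i _; ring.
Qed.

(** * Coefficient extraction and the eigenvector identity *)

Lemma coef_1subXn_exp (R : comNzRingType) b N (G : {poly R}) t : (0 < b)%N ->
  ((1 - 'X^b) ^+ N * G)`_t =
  \sum_(r < (t %/ b).+1) (-1) ^+ r * ('C(N, r))%:R * G`_(t - b * r).
Proof.
move=> b0.
pose F r := (-1) ^+ r * ('C(N, r))%:R * (if (t < b * r)%N then 0 else G`_(t - b * r)).
have -> : ((1 - 'X^b) ^+ N * G)`_t = \sum_(r < N.+1) F r.
  rewrite exprBn mulr_suml coef_sum; apply: eq_bigr => r _.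
  have -> : (-1) ^+ r * 1 ^+ (N - r) * 'X^b ^+ r *+ 'C(N, r) * G
          = ((-1) ^+ r * 'C(N, r)%:R)%:P * ('X^(b * r) * G).
    rewrite expr1n mulr1 -exprM mulrA rmorphM rmorphXn rmorphN1 rmorph_nat.
    by rewrite mulr_natr !mulrnAl.
  by rewrite coefCM coefXnM.
(* Both ranges are widened to their maximum: the binomial kills r > N, and the test in [F] kills r >
   t / b. *)
transitivity (\sum_(r < maxn N.+1 (t %/ b).+1) F r).
  rewrite (@big_ord_widen _ _ _ _ _ F (leq_maxl N.+1 (t %/ b).+1)) big_mkcond /=.
  by apply: eq_bigr => r _; case: ifP => // /negbT h; rewrite /F bin_small ?mulr0 ?mul0r //; lia.
have E r : (t < b * r)%N = ~~ (r < (t %/ b).+1)%N.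
  by rewrite ltnS leq_divRL // mulnC ltnNge.
transitivity (\sum_(r < (t %/ b).+1) F r); last first.
  by apply: eq_bigr => r _; rewrite /F E ltn_ord.
rewrite [RHS](@big_ord_widen _ _ _ _ _ F (leq_maxr N.+1 _)) [RHS]big_mkcond /=.
by apply: eq_bigr => r _; rewrite /F E; case: ltnP => _ /=; rewrite ?mulr0.
Qed.

(** A truncated power series; coefficients below degree [K] are unaffected, so [K] is chosen above
    the degree being read. *)
Definition powseries (R : comNzRingType) (p : R) (e K : nat) : {poly R} :=
  \poly_(k < K) (p * k%:R + 1) ^+ e.

Lemma coef_eulsum (R : comNzRingType) (p : R) N e j K : (j < K)%N ->
  ((1 - 'X) ^+ N * powseries p e K)`_j = eulsum p N e j.
Proof.
move=> jK; rewrite -['X]expr1 coef_1subXn_exp // divn1; apply: eq_bigr => r _.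
by rewrite mul1n coef_poly ifT //; lia.
Qed.

Lemma coefMl_eq (R : nzRingType) (f g h : {poly R}) t :
  (forall k, (k <= t)%N -> f`_k = g`_k) -> (f * h)`_t = (g * h)`_t.
Proof. by move=> fg; rewrite !coefM; apply: eq_bigr => i _; rewrite fg // -ltnS. Qed.

Definition blockpoly (R : comNzRingType) (b : nat) : {poly R} := \sum_(i < b) 'X^i.

Lemma blockpolyE (R : comNzRingType) b : (1 - 'X) * blockpoly R b = 1 - 'X^b.
Proof. by rewrite -opprB mulNr -subrX1 opprB. Qed.

Lemma eulsum_eigen (R : comNzRingType) (p : R) (b n e m T j : nat) :
  (0 < b)%N -> (T < b)%N -> p * T%:R = b%:R - 1 ->
  (forall k, (m <= k)%N -> eulsum p n.+1 e k = 0) ->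
  \sum_(k < m) eulsum p n.+1 e k * ('X^k * blockpoly R b ^+ n.+1)`_(b * j + T)
  = b%:R ^+ e * eulsum p n.+1 e j.
Proof.
move=> b0 Tb pT vm; set t := (b * j + T)%N.
transitivity ((\poly_(k < m) eulsum p n.+1 e k * blockpoly R b ^+ n.+1)`_t).
  rewrite poly_def mulr_suml coef_sum; apply: eq_bigr => k _.
  by rewrite -scalerAl coefZ.
(* By [vm] the cut at m loses nothing, so the two left factors agree up to degree t. *)
rewrite (@coefMl_eq _ _ ((1 - 'X) ^+ n.+1 * powseries p e t.+1)); last first.
  by move=> k kt; rewrite coef_eulsum ?ltnS // coef_poly; case: ltnP => // /vm.
rewrite mulrAC -exprMn_comm; last exact: mulrC.
rewrite blockpolyE coef_1subXn_exp //.
have -> : (t %/ b = j)%N by rewrite /t mulnC divnMDl // divn_small ?addn0.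
rewrite mulr_sumr; apply: eq_bigr => r _.
have rj : (r <= j)%N by rewrite -ltnS.
rewrite coef_poly ltnS leq_subr mulrCA -exprMn; congr (_ * _ ^+ _).
have -> : (t - b * r = b * (j - r) + T)%N by rewrite /t mulnBr; nia.
by rewrite natrD natrM mulrDr pT; ring.
Qed.

(** * One step of the chain as a polynomial coefficient *)

Lemma sum_ord_shift (R : nzSemiRingType) b a t :
  \sum_(u < b) (a + u == t)%N%:R = (a <= t < a + b)%N%:R :> R.
Proof.
case: (boolP (a <= t < a + b)%N) => h.
  have hu : (t - a < b)%N by lia.
  rewrite (bigD1 (Ordinal hu)) //= subnKC ?eqxx; last by lia.
  rewrite big1 ?addr0 // => u; rewrite -val_eqE /= => hne.
  by case: eqP => // E; move: hne; rewrite -E addKn eqxx.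
by rewrite big1 // => u _; case: eqP => // E; move: h; have := ltn_ord u; lia.
Qed.

(** The digit A takes back one of the n offsets d, which leaves the drift (n - 1) d. *)
Lemma next_carryE b n d c (x : {ffun 'I_n -> 'I_b}) : (0 < b)%N ->
  next_carry d c x = ((c + (n%:Z - 1) * d + (\sum_(k < n) x k)%N%:Z) %/ b)%Z.
Proof.
move=> b0; rewrite /next_carry /digit_sum.
have -> : \sum_(k < n) (d + (x k : nat)%:Z) = n%:Z * d + (\sum_(k < n) x k)%N%:Z.
  rewrite big_split /= sumr_const card_ord -mulr_natl natz; congr (_ + _).
  by rewrite -natz natr_sum; apply: eq_bigr => k _; rewrite natz.
set S := c + _; have -> : S = c + (n%:Z - 1) * d + (\sum_(k < n) x k)%N%:Z + d.
  by rewrite /S; ring.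
rewrite addrK; set S' := c + _ + _.
have -> : S' + d - (d + (S' %% b)%Z) = (S' %/ b)%Z * b.
  by rewrite {1}(divz_eq S' b); ring.
by rewrite mulzK //; lia.
Qed.

Lemma next_carry_ge b n d c c' (x : {ffun 'I_n -> 'I_b}) : (0 < b)%N ->
  (c' <= next_carry d c x) =
  (c' * b%:Z <= c + (n%:Z - 1) * d + (\sum_(k < n) x k)%N%:Z).
Proof. by move=> b0; rewrite next_carryE // lez_divRL. Qed.

Lemma next_carry_eq b n d c c' (x : {ffun 'I_n -> 'I_b}) : (0 < b)%N ->
  (next_carry d c x == c') =
  (c' * b%:Z <= c + (n%:Z - 1) * d + (\sum_(k < n) x k)%N%:Z < (c' + 1) * b%:Z).
Proof.
by move=> b0; rewrite ltNge -!next_carry_ge // -ltNge ltzD1 eq_le andbC.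
Qed.

Lemma blockpoly_exp (R : comNzRingType) b n :
  blockpoly R b ^+ n = \sum_(x : {ffun 'I_n -> 'I_b}) 'X^(\sum_(k < n) x k).
Proof.
rewrite -[n in LHS]card_ord -prodr_const /blockpoly bigA_distr_bigA /=.
by apply: eq_bigr => x _; rewrite expr_sum.
Qed.

(* The factor 'X^k makes the coefficient vanish when b j + T < k. *)
Lemma trans_probE b n d s T k j : (T < b)%N ->
  T%:Z = (b%:Z - 1) * (s + 1) - (n%:Z - 1) * d ->
  trans_prob b n d (s + k%:Z) (s + j%:Z) =
  ('X^k * blockpoly rat b ^+ n.+1)`_(b * j + T) / (b ^ n)%:R.
Proof.
move=> Tb TE; have b0 : (0 < b)%N by apply: leq_trans Tb.
congr (_ / _); rewrite exprSr blockpoly_exp mulr_suml mulr_sumr coef_sum.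
rewrite -sum1_card natr_sum big_mkcond /=; apply: eq_bigr => x _.
rewrite inE /blockpoly !mulr_sumr coef_sum.
rewrite (eq_bigr (fun u : 'I_b =>
  (k + \sum_(i < n) x i + u == b * j + T)%N%:R)); last first.
  by move=> u _; rewrite -!exprD coefXn eq_sym addnA.
(* Summing over the additional digit u tests a window of length b, as the floor does: k + S <= b j +
   T is the strict upper bound on the carry, b j + T < k + S + b the lower one. *)
rewrite sum_ord_shift next_carry_eq //; set S := (\sum_(_ < _) _)%N.
rewrite -[LHS]/(if _ then 1%:R else 0%:R) -(fun_if (fun i : nat => i%:R)).
by congr (_%:R); rewrite -[LHS]/(nat_of_bool _); congr nat_of_bool; lia.
Qed.

(** * Extremal states, their number, and the parameter p *)

(** The half-line from c0 contains 0 and is stable under a step: the worst case is c = c0 with all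
    x_k = 0. *)
Lemma reachable_ge b n d c0 : (0 < b)%N -> c0 <= 0 ->
  (b%:Z - 1) * c0 <= (n%:Z - 1) * d ->
  forall c, reachable b n d c -> c0 <= c.
Proof.
move=> b0 c00 h c; elim=> // {}c x _ IH; rewrite next_carry_ge //.
move: (\sum_(_ < _) _)%N => S; nia.
Qed.

Lemma digits_le b n (x : {ffun 'I_n -> 'I_b}) :
  (\sum_(k < n) x k <= n * b.-1)%N.
Proof.
rewrite -[n in (n * _)%N]card_ord -sum_nat_const; apply: leq_sum => k _.
by have := ltn_ord (x k); lia.
Qed.

(** Here the worst case is c = c0 - 1 with all x_k = b - 1. *)
Lemma reachable_lt b n d c0 : (0 < b)%N -> 0 < c0 ->
  (n%:Z - 1) * d + n%:Z * (b%:Z - 1) <= (b%:Z - 1) * c0 ->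
  forall c, reachable b n d c -> c < c0.
Proof.
move=> b0 c00 h c; elim=> // {}c x _ IH; rewrite ltNge next_carry_ge // -ltNge.
have := digits_le x; move: (\sum_(_ < _) _)%N => S; nia.
Qed.

(* The integer (b - 1) (1 - frac ((n - 1) l)), which equals (b - 1) / p. *)
Definition shiftT (b n : nat) (d s : int) : nat :=
  absz ((b%:Z - 1) * (s + 1) - (n%:Z - 1) * d)%R.

Section StateSpace.

Variables (b n : nat) (d s : int) (m : nat).
Hypotheses (b2 : (2 <= b)%N) (n1 : (1 <= n)%N).
Hypotheses (d0 : d <= 0) (db : 0 <= d + (b : int) - 1).
Hypothesis Omega : forall c : int, reachable b n d c <-> (s <= c /\ c < s + (m : int)).

Let T := shiftT b n d s.

Let b0 : (0 < b)%N. Proof. exact: ltnW. Qed.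

(** A step from s with all x_k = 0 cannot go below s. If the strict bound failed, d <= 0 would give
    s + 1 <= 0, and [reachable_ge] at s + 1 would exclude s. *)
Lemma state_s : (b%:Z - 1) * s <= (n%:Z - 1) * d < (b%:Z - 1) * (s + 1).
Proof.
have [s0 sm] : s <= 0 /\ 0 < s + m%:Z by apply/Omega; constructor.
have rs : reachable b n d s by apply/Omega; lia.
apply/andP; split.
  have [+ _] := (Omega _).1 (reachS [ffun=> Ordinal b0] rs).
  rewrite next_carry_ge // big1 => [|k _]; last by rewrite ffunE.
  by lia.
rewrite ltNge; apply/negP => h; suff : s + 1 <= s by lia.
by apply: reachable_ge rs => //; nia.
Qed.

Lemma state_m : (b%:Z - 1) * (s + m%:Z - 1) < (n%:Z - 1) * d + n%:Z * (b%:Z - 1)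
  <= (b%:Z - 1) * (s + m%:Z).
Proof.
have [s0 sm] : s <= 0 /\ 0 < s + m%:Z by apply/Omega; constructor.
have rM : reachable b n d (s + m%:Z - 1) by apply/Omega; lia.
have bb : (b.-1 < b)%N by lia.
apply/andP; split; last first.
  have [_] := (Omega _).1 (reachS [ffun=> Ordinal bb] rM).
  rewrite ltNge next_carry_ge // (eq_bigr (fun=> b.-1)) => [|k _]; last by rewrite ffunE.
  by rewrite sum_nat_const card_ord; nia.
rewrite ltNge; apply/negP => h; suff : s + m%:Z - 1 < s + m%:Z - 1 by lia.
by apply: reachable_lt rM => //; nia.
Qed.

Lemma shiftTE : T%:Z = (b%:Z - 1) * (s + 1) - (n%:Z - 1) * d.
Proof. by rewrite /T /shiftT; have := state_s; lia. Qed.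

Lemma shiftT_itv : (0 < T < b)%N.
Proof. by have := shiftTE; have := state_s; nia. Qed.

(** Inserting [shiftTE] into [state_m] gives n + 1 - m = floor (T / (b - 1)), which is 1 if T = b -
    1 and 0 otherwise. *)
Lemma state_card : m = (n + (T != b.-1))%N.
Proof.
have := shiftTE; have := shiftT_itv; have := state_m.
case: eqP => /= h; nia.
Qed.

(** Write (n - 1) l = s + 1 - y with y = T / (b - 1) in (0, 1]. If y < 1, it is the fractional part
    of -(n - 1) l; y = 1 is the integral case. So 1 / y covers both branches. *)
Lemma pparamE : pparam b n d = (b%:R - 1) / T%:R.
Proof.
have /andP[T0 Tb] := shiftT_itv.
have b1 : 0 < b%:R - 1 :> rat by rewrite subr_gt0 ltr1n.
have TE : T%:R = (b%:R - 1) * (s%:~R + 1) - (n%:R - 1) * d%:~R :> rat.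
  have /(congr1 (fun z : int => z%:~R : rat)) := shiftTE.
  by rewrite !(rmorphM, rmorphB, rmorphD) /= => H; exact: H.
pose y : rat := T%:R / (b%:R - 1).
have y0 : 0 < y by rewrite divr_gt0 // ltr0n.
have lE : (n%:R - 1) * ell b d = s%:~R + 1 - y.
  by rewrite /ell /y TE; field; rewrite lt0r_neq0.
have -> : (b%:R - 1) / T%:R = y^-1 by rewrite /y invf_div.
have b1E : b%:R - 1 = b.-1%:R :> rat by rewrite -subn1 natrB.
have [TE'|Tne] := eqVneq T b.-1.
  have y1 : y = 1 by rewrite /y b1E -TE' divff // pnatr_eq0; lia.
  by rewrite /pparam lE y1 addrK intr_int invr1.
have y1 : y < 1 by rewrite /y ltr_pdivrMr // mul1r b1E ltr_nat; lia.
rewrite /pparam mulrN lE ifF.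
  congr (_^-1); rewrite /Defs.fracq (@floor_def _ _ (- (s + 1))).
    by rewrite rmorphN rmorphD /=; ring.
  by rewrite !rmorphD !rmorphN !rmorphD /=; lra.
rewrite intrEfloor (@floor_def _ _ s) ?rmorphD /=; last by lra.
by apply/negP => /eqP; lra.
Qed.

End StateSpace.

(** * Diagonalisation and the stationary distribution *)

Theorem theorem1 (b n : nat) (d s : int) (m : nat)
  (hb : (2 <= b)%N) (hn : (1 <= n)%N)
  (hd0 : d <= 0) (hd1 : 0 <= d + (b : int) - 1)
  (hOmega : forall c : int, reachable b n d c <-> (s <= c /\ c < s + (m : int))) :
  let P := carry_matrix b n d s m in
  let p := pparam b n d in
  let V := Vmatrix p n m in
  [/\ V \in unitmx,
      V *m P *m invmx V = diag_mx (\row_(i < m) ((b%:R : rat) ^- (i : nat)))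
    & let pi := \row_(k < m) (Aeul p n k / (p ^+ n * (n`!)%:R)) in
      [/\ (forall k, 0 <= pi 0 k), \sum_(k < m) pi 0 k = 1, pi *m P = pi &
          forall pi' : 'rV[rat]_m,
            (forall k, 0 <= pi' 0 k) -> \sum_(k < m) pi' 0 k = 1 ->
            pi' *m P = pi' -> pi' = pi]
  ].
Proof.
move=> P p V.
have b0 : (0 < b)%N by apply: ltnW.
have bR : (b%:R : rat) != 0 by rewrite pnatr_eq0 -lt0n.
set T := shiftT b n d s.
have TE : T%:Z = _ := shiftTE hb hn hd0 hd1 hOmega.
have /andP[T0 Tb] : (0 < T < b)%N := shiftT_itv hb hn hd0 hd1 hOmega.
have mE : m = _ := state_card hb hn hd0 hd1 hOmega.
have pE : p = (b%:R - 1) / T%:R := pparamE hb hn hd0 hd1 hOmega.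
have pT : p * T%:R = b%:R - 1 by rewrite pE divfK // pnatr_eq0; lia.
have p1 : 1 <= p.
  rewrite pE ler_pdivlMr ?ltr0n // mul1r -[leRHS]/(b%:R - 1%:R) -natrB // ler_nat; lia.
have m0 : (0 < m)%N by lia.
have im (i : 'I_m) : (i <= n)%N by have := ltn_ord i; lia.
(* If m = n then p = 1, and e = 0 must be excluded because it yields (1 - z)^n, of degree n; the
   rows i < n only involve e = n - i > 0. *)
have vout e k : (e <= n)%N -> (n - m < e)%N || (m == n.+1) -> (m <= k)%N ->
    eulsum p n.+1 e k = 0.
  move=> en; move: mE; rewrite -/T; case: eqP => /= [TE' mE' e0 mk|_ mE' _ mk].
    have -> : p = 1.
      rewrite pE TE' -subn1 natrB // divff // subr_eq0 -[1]/(1%:R) eqr_nat; lia.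
    by apply: eulsum1_out; lia.
  by apply: eulsum_out; lia.
have VP (i : 'I_m) : row i V *m P = b%:R ^- i *: row i V.
  apply/rowP => j; rewrite !mxE.
  transitivity ((b ^ n)%:R^-1 * \sum_(k < m) eulsum p n.+1 (n - i) k
                * ('X^k * blockpoly rat b ^+ n.+1)`_(b * j + T)).
    rewrite mulr_sumr; apply: eq_bigr => k _.
    by rewrite !mxE (trans_probE _ _ Tb TE) /veul -/(eulsum p n.+1 (n - i) k); ring.
  rewrite eulsum_eigen //; last first.
    by move=> k; apply: vout; rewrite ?leq_subr //; have := ltn_ord i; lia.
  rewrite mulrA; congr (_ * _).
  (* The eigenvalue is b^(n - i) / b^n, the denominator being the number of digit vectors. *)
  rewrite natrX -[X in _ ^+ X](subnK (im i)) exprD invfM -mulrA mulrCA.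
  by rewrite mulVf ?mulr1 ?expf_neq0.
have VPm : V *m P = diag_mx (\row_(i < m) (b%:R ^- i)) *m V.
  apply/row_matrixP => i; rewrite row_mul VP; apply/rowP => j.
  rewrite !mxE (bigD1 i) //= !mxE eqxx big1 ?addr0 // => k ki.
  by rewrite !mxE eq_sym (negPf ki) mul0r.
(* Column 0 of V is constant 1, so V turns the columns P^k e_0 into a Vandermonde matrix. *)
have VU : V \in unitmx.
  pose i0 := Ordinal m0.
  pose K : 'M[rat]_m := \matrix_(i, k) (iter k (mulmx P) 1%:M) i i0.
  pose a : 'rV[rat]_m := \row_i (b%:R ^- i).
  have VK : V *m K = (Vandermonde m a)^T.
    apply/matrixP => i k; rewrite !mxE.
    transitivity ((V *m iter k (mulmx P) 1%:M) i i0).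
      by rewrite mxE; apply: eq_bigr => j _; rewrite !mxE.
    have -> : V *m iter k (mulmx P) 1%:M = iter k (mulmx (diag_mx a)) V.
      elim: (k : nat) => [|k' IH] /=; first by rewrite mulmx1.
      rewrite mulmxA VPm -mulmxA IH //.
    elim: (k : nat) => [|k' IH] /=; first by rewrite mxE [LHS]eulsum_at0.
    by rewrite mul_diag_mx mxE IH !mxE exprS.
  suff : V *m K \in unitmx by rewrite unitmx_mul => /andP[].
  rewrite VK unitmx_tr unitmxE det_Vandermonde unitfE.
  apply/prodf_neq0 => i _; apply/prodf_neq0 => j ij; rewrite !mxE subr_eq0.
  apply: contraTneq ij => /invr_inj /eqP; rewrite -!natrX eqr_nat eqn_exp2l //.
  by move=> /eqP ->; rewrite ltnn.
have c0 : p ^+ n * n`!%:R != 0.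
  by rewrite mulf_neq0 ?expf_neq0 ?pnatr_eq0 -?lt0n ?fact_gt0 ?gt_eqF // (lt_le_trans _ p1).
pose c := p ^+ n * n`!%:R.
(* When m = n, the entry at index n missing from the sum is zero by [vout]. *)
have sumV : \sum_(k < m) Aeul p n k = c.
  have mn : (m <= n.+1)%N by lia.
  rewrite /c -sum_eulsum (big_ord_widen _ (Aeul p n) mn) big_mkcond /=.
  apply: eq_bigr => k _; rewrite /Aeul /veul subn0 -/(eulsum p n.+1 n k).
  by case: ltnP => // mk; rewrite vout //; lia.
split=> // [|pi]; first by rewrite VPm mulmxK.
pose i0 := Ordinal m0.
have piE : pi = c^-1 *: row i0 V by apply/rowP => k; rewrite !mxE mulrC.
have pisum : \sum_(k < m) pi 0 k = 1.
  by under eq_bigr do rewrite mxE; rewrite -mulr_suml sumV divff.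
split=> //.
- move=> k; rewrite mxE divr_ge0 //; first by rewrite /Aeul /veul subn0; exact: eulsum_ge0.
  by rewrite mulr_ge0 ?exprn_ge0 // (le_trans _ p1).
- by rewrite piE -scalemxAl VP invr1 scale1r.
move=> pi' _ sum' stat.
(* In the basis of rows of V, stationarity reads w_i b^-i = w_i, so only w_0 survives; the total
   mass then fixes it. *)
have [w wV] : exists w, pi' = w *m V.
  by exists (pi' *m invmx V); rewrite mulmxKV.
have wD : w *m diag_mx (\row_(i < m) (b%:R ^- i)) = w.
  apply: (can_inj (mulmxK VU)).
  by rewrite -mulmxA -VPm mulmxA -wV.
have w0 (i : 'I_m) : i != i0 -> w 0 i = 0.
  move=> ii; have /rowP/(_ i) := wD; rewrite mul_mx_diag !mxE => /eqP.
  rewrite -subr_eq0 -{2}[w 0 i]mulr1 -mulrBr mulf_eq0 => /orP[/eqP //|].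
  rewrite subr_eq0 invr_eq1 -natrX -[1]/(1%:R) eqr_nat.
  rewrite -[X in _ == X](expn0 b) eqn_exp2l // => /eqP i00.
  by case/eqP: ii; apply/val_inj.
have pi'E : pi' = w 0 i0 *: row i0 V.
  rewrite {1}wV; apply/rowP => k; rewrite !mxE (bigD1 i0) //= big1 ?addr0 ?mxE //.
  by move=> i /w0 ->; rewrite mul0r.
have pi'pi : pi' = (w 0 i0 * c) *: pi by rewrite piE scalerA mulfK.
rewrite pi'pi; suff -> : w 0 i0 * c = 1 by rewrite scale1r.
rewrite -sum' pi'pi; under eq_bigr do rewrite mxE.
by rewrite -mulr_sumr pisum mulr1.
Qed.
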